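(* $\mathrm{GRA}(e,p,s,I,J,\exists)$ is equiexpressive with the set of conjunctive queries with equality ($\mathrm{CQE}$s). Also, $\mathrm{GRA}(p,s,I,J,\exists)$ is equiexpressive with the set of conjunctive queries ($\mathrm{CQ}$s).
   Context: AD-relations. $A^0=\{\epsilon\}$, with $\epsilon$ the empty tuple. A $k$-ary AD-relation over a set $A$ is a pair $(R,k)$ with $R\subseteq A^k$, $k\ge 0$; $t\in(R,k)$ means $t\in R$. Vocabularies contain only relation symbols (of any arity $k\ge 0$). Models have nonempty domains; $A$ is the domain of $\mathfrak{A}$. Terms. $\mathrm{GRA}(e,p,s,I,J,\exists)$ is the set of terms built from relation symbols and the constant $e$ by the unary operators $p,s,I,\exists$ and the binary operator $J$; $\mathrm{GRA}(p,s,I,J,\exists)$ is the set of those terms not using $e$. Each term $\mathcal{T}$ defines in each model $\mathfrak{A}$ an AD-relation $\mathcal{T}^{\mathfrak{A}}$ of arity $\mathit{ar}(\mathcal{T})$. Let $k=\mathit{ar}(\mathcal{T})$, $\ell=\mathit{ar}(\mathcal{S})$. - $R^{\mathfrak{A}}$ is the interpretation of $R$, paired with the arity of $R$; $e^{\mathfrak{A}}=(\{(a,a)\mid a\in A\},2)$. - If $k\ge2$: $(p\mathcal{T})^{\mathfrak{A}}=(\{(a_k,a_1,\dots,a_{k-1})\mid(a_1,\dots,a_k)\in\mathcal{T}^{\mathfrak{A}}\},k)$; $(s\mathcal{T})^{\mathfrak{A}}=(\{(a_1,\dots,a_{k-2},a_k,a_{k-1})\mid(a_1,\dots,a_k)\in\mathcal{T}^{\mathfrak{A}}\},k)$;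 $(I\mathcal{T})^{\mathfrak{A}}=(\{(a_1,\dots,a_{k-1})\mid(a_1,\dots,a_k)\in\mathcal{T}^{\mathfrak{A}},\ a_{k-1}=a_k\},k-1)$. If $k\le1$, each of $p\mathcal{T},s\mathcal{T},I\mathcal{T}$ is interpreted as $\mathcal{T}^{\mathfrak{A}}$. - $(J(\mathcal{T},\mathcal{S}))^{\mathfrak{A}}=(\{(a_1,\dots,a_k,b_1,\dots,b_\ell)\mid(a_1,\dots,a_k)\in\mathcal{T}^{\mathfrak{A}},(b_1,\dots,b_\ell)\in\mathcal{S}^{\mathfrak{A}}\},k+\ell)$. - If $k\ge1$: $(\exists\mathcal{T})^{\mathfrak{A}}=(\{(a_1,\dots,a_{k-1})\mid(a_1,\dots,a_k)\in\mathcal{T}^{\mathfrak{A}}\text{ for some }a_k\in A\},k-1)$; if $k=0$: $(\exists\mathcal{T})^{\mathfrak{A}}=\mathcal{T}^{\mathfrak{A}}$. Formulas. Variables are $v_1,v_2,\dots$. A conjunctive query (CQ) is a formula $\exists x_1\dots\exists x_k\,\psi$ where $\psi$ is a conjunction of relation atoms $R(y_1,\dots,y_n)$. A conjunctive query with equality (CQE) is like a CQ but also allows equality atoms in addition to relation atoms. A formula $\varphi$ whose free variables are exactly $v_{i_1},\dots,v_{i_k}$ with $i_1<\dots<i_k$ defines $\varphi^{\mathfrak{A}}=(\{(a_1,\dots,a_k)\in A^k\mid\mathfrak{A}\models\varphi(a_1,\dots,a_k)\},k)$, where $a_j$ is assigned to $v_{i_j}$. A formula $\varphi$ and a term $\mathcal{T}$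 are equivalent if $\varphi^{\mathfrak{A}}=\mathcal{T}^{\mathfrak{A}}$ for every model $\mathfrak{A}$ whose vocabulary contains all symbols of $\varphi$ and $\mathcal{T}$. A set of terms and a set of formulas are equiexpressive if each term in the former has an equivalent formula in the latter and each formula in the latter has an equivalent term in the former. *)

(* Defs.v *)
From mathcomp Require Import all_boot.
From mathcomp Require Import classical_sets.

Set Implicit Arguments.
Unset Strict Implicit.
Unset Printing Implicit Defensive.

Local Open Scope classical_set_scope.

Record ad_rel (A : Type) := AdRel {
  ad_ar : nat;
  ad_set : set (ad_ar.-tuple A)
}.
Arguments ad_set {A} _ _.

Section ADRelations.
Variable A : Type.
Implicit Types (X Y : ad_rel A) (u v w : seq A).

(* Tuples of a relation viewed as plain sequences, so that the operators can
   be written with rcons and cat and no casts between arities. *)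
Definition ad_in X u : Prop := exists2 t, ad_set X t & tval t = u.

Definition ad_mk (k : nat) (P : seq A -> Prop) : ad_rel A :=
  AdRel [set t : k.-tuple A | P (tval t)].

Definition ad_e : ad_rel A := ad_mk 2 (fun w => exists a, w = [:: a; a]).

Definition ad_p X : ad_rel A :=
  if 2 <= ad_ar X then
    ad_mk (ad_ar X) (fun w => exists u a, w = a :: u /\ ad_in X (rcons u a))
  else X.

Definition ad_s X : ad_rel A :=
  if 2 <= ad_ar X then
    ad_mk (ad_ar X) (fun w => exists u a b,
      w = rcons (rcons u b) a /\ ad_in X (rcons (rcons u a) b))
  else X.

Definition ad_I X : ad_rel A :=
  if 2 <= ad_ar X then
    ad_mk (ad_ar X).-1 (fun w => exists u a,
      w = rcons u a /\ ad_in X (rcons (rcons u a) a))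
  else X.

Definition ad_J X Y : ad_rel A :=
  ad_mk (ad_ar X + ad_ar Y) (fun w => exists u v,
    [/\ w = u ++ v, ad_in X u & ad_in Y v]).

Definition ad_ex X : ad_rel A :=
  if 1 <= ad_ar X then
    ad_mk (ad_ar X).-1 (fun w => exists a, ad_in X (rcons w a))
  else X.

End ADRelations.

(* Sym is the collection of all relation symbols, ar their arities; each model
   has its own vocabulary, a subset of Sym. *)
Record model (Sym : Type) (ar : Sym -> nat) := Model {
  dom : Type;
  dom_inhabited : inhabited dom;
  voc : set Sym;
  interp : forall R : Sym, voc R -> set ((ar R).-tuple dom)
}.

Section Syntax.
Variables (Sym : Type) (ar : Sym -> nat).

Inductive term :=
| TRel of Sym
| TEq
| TP of term
| TS of term
| TI of term
| TJ of term & term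
| TEx of term.

Fixpoint e_free (T : term) : bool :=
  match T with
  | TRel _ => true
  | TEq => false
  | TP T1 | TS T1 | TI T1 | TEx T1 => e_free T1
  | TJ T1 T2 => e_free T1 && e_free T2
  end.

Fixpoint term_syms (T : term) : set Sym :=
  match T with
  | TRel R => [set R]
  | TEq => set0
  | TP T1 | TS T1 | TI T1 | TEx T1 => term_syms T1
  | TJ T1 T2 => term_syms T1 `|` term_syms T2
  end.

(* The natural number i stands for the variable v_(i+1).  Only the connectives
   occurring in conjunctive queries are included. *)
Inductive formula :=
| FRel (R : Sym) of (ar R).-tuple nat
| FEq of nat & nat
| FAnd of formula & formula
| FEx of nat & formula.

Fixpoint formula_syms (f : formula) : set Sym :=
  match f with
  | FRel R _ => [set R]
  | FEq _ _ => set0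
  | FAnd f1 f2 => formula_syms f1 `|` formula_syms f2
  | FEx _ f1 => formula_syms f1
  end.

Fixpoint free_occ (f : formula) : seq nat :=
  match f with
  | FRel _ y => y
  | FEq x y => [:: x; y]
  | FAnd f1 f2 => free_occ f1 ++ free_occ f2
  | FEx x f1 => [seq z <- free_occ f1 | z != x]
  end.

Definition free_vars (f : formula) : seq nat := sort leq (undup (free_occ f)).

Definition rel_atom : set formula := [set f | exists R y, f = @FRel R y].

Definition eq_atom : set formula := [set f | exists x y, f = FEq x y].

(* A conjunction has at least one conjunct: with the empty conjunction allowed,
   "true" would be a CQ, which no e-free term over the empty set of relation
   symbols can express. *)
Inductive conjunction (atom : set formula) : set formula :=
| conj_atom f : atom f -> conjunction atom f
| conj_and f g :
    conjunction atom f -> conjunction atom g -> conjunction atom (FAnd f g).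

Definition query (atom : set formula) : set formula :=
  [set f | exists (xs : seq nat) (g : formula),
             conjunction atom g /\ f = foldr FEx g xs].

Definition CQ : set formula := query rel_atom.

Definition CQE : set formula := query (rel_atom `|` eq_atom).

Definition GRA_epsIJex : set term := setT.

Definition GRA_psIJex : set term := [set T | e_free T].

End Syntax.

Arguments TEq {Sym}.
Arguments FEq {Sym ar}.
Arguments GRA_epsIJex {Sym}.
Arguments GRA_psIJex {Sym}.

Section Semantics.
Variables (Sym : Type) (ar : Sym -> nat).

(* A symbol outside the vocabulary denotes the empty relation; equivalence
   below only looks at models whose vocabulary has all the symbols involved. *)
Definition rel_val (M : model ar) (R : Sym) : set ((ar R).-tuple (dom M)) :=
  [set t | exists h : voc M R, interp h t].
Arguments rel_val : clear implicits.

Fixpoint term_val (M : model ar) (T : term Sym) : ad_rel (dom M) :=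
  match T with
  | TRel R => AdRel (rel_val M R)
  | TEq => ad_e (dom M)
  | TP T1 => ad_p (term_val M T1)
  | TS T1 => ad_s (term_val M T1)
  | TI T1 => ad_I (term_val M T1)
  | TJ T1 T2 => ad_J (term_val M T1) (term_val M T2)
  | TEx T1 => ad_ex (term_val M T1)
  end.

Fixpoint sat (M : model ar) (h : nat -> dom M) (f : formula ar) : Prop :=
  match f with
  | FRel R y => rel_val M R (map_tuple h y)
  | FEq x y => h x = h y
  | FAnd f1 f2 => sat h f1 /\ sat h f2
  | FEx x f1 => exists a : dom M,
      sat (fun z => if z == x then a else h z) f1
  end.

(* Assigning a_1, ..., a_k to the free variables in increasing order: h is any
   total assignment extending this one, its other values being irrelevant. *)
Definition formula_val (M : model ar) (f : formula ar) : ad_rel (dom M) :=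
  ad_mk (size (free_vars f)) (fun w => exists h : nat -> dom M,
    map h (free_vars f) = w /\ sat h f).

Definition equivalent (f : formula ar) (T : term Sym) : Prop :=
  forall M : model ar,
    formula_syms f `|` term_syms T `<=` voc M ->
    formula_val M f = term_val M T.

Definition equiexpressive (Ts : set (term Sym)) (Fs : set (formula ar)) : Prop :=
  (forall T, Ts T -> exists2 f, Fs f & equivalent f T) /\
  (forall f, Fs f -> exists2 T, Ts T & equivalent f T).

End Semantics.

(* Main.v *)
Require Import Defs.
From mathcomp Require Import all_boot.
From mathcomp Require Import zify boolp classical_sets.

(** A term is tracked by a quantifier-free conjunction together with the list
    of variables naming its columns: p and s rearrange the list, I renames one
    variable to another, J renames both conjunctions apart, and the projection
    drops a variable from the list; quantifying the variables outside the list
    at the very end gives the query.  Conversely a conjunction is the join of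
    its atoms, with columns labelled by variables.  As p and s generate all
    permutations, equal labels can be brought to the end and merged by I,
    quantified labels brought to the end and projected away, and the remaining
    labels sorted. *)

Set Implicit Arguments.
Unset Strict Implicit.
Unset Printing Implicit Defensive.

(** * Closure under all permutations from a rotation and a swap of the last two entries *)

Section PermutationClosure.
Variables (T : eqType) (P : seq T -> Prop).
Hypothesis P_rot1 : forall u a, P (rcons u a) -> P (a :: u).
Hypothesis P_swap : forall u a b,
  P (rcons (rcons u a) b) -> P (rcons (rcons u b) a).

Lemma closed_catC u v : P (u ++ v) -> P (v ++ u).
Proof.
elim/last_ind: v u => [|v a IHv] u; first by rewrite cats0.
by rewrite -rcons_cat => /P_rot1; rewrite -cat_cons => /IHv; rewrite cat_rcons.
Qed.

(** Rotating [v] to the front makes [a] and [b] the last two entries, where [P_swap] applies;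
    rotating back restores the rest. *)
Lemma closed_swap_mid u v a b : P (u ++ a :: b :: v) -> P (u ++ b :: a :: v).
Proof.
have catE c d : u ++ c :: d :: v = rcons (rcons u c) d ++ v.
  by rewrite !cat_rcons.
rewrite !catE => /closed_catC; rewrite -!rcons_cat => /P_swap.
by rewrite !rcons_cat => /closed_catC.
Qed.

Lemma closed_move u v w a : P (u ++ a :: v ++ w) -> P (u ++ v ++ a :: w).
Proof.
elim: v u => //= b v IHv u /closed_swap_mid.
by rewrite -!(cat_rcons b u) => /IHv.
Qed.

Lemma closed_perm_eq v w : perm_eq v w -> P v -> P w.
Proof.
(* The prefix [u] collects the entries of the target list that are already in place. *)
suff gen u : perm_eq v w -> P (u ++ v) -> P (u ++ w) by apply: (gen [::]).
elim: v w u => [|a v IHv] w u.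
  by rewrite perm_sym => /perm_nilP ->.
move=> eq_vw; have aw : a \in w by rewrite -(perm_mem eq_vw) mem_head.
case/splitPr: aw eq_vw => w1 w2 eq_vw.
have {}eq_vw : perm_eq v (w1 ++ w2).
  by rewrite -(perm_cons a) (perm_trans eq_vw) // (perm_catCA w1 [:: a]).
rewrite -cat_rcons => /(IHv _ _ eq_vw).
by rewrite cat_rcons; apply: closed_move.
Qed.

End PermutationClosure.

Lemma cat_inj (T : Type) (u u' v v' : seq T) :
  size u = size u' -> u ++ v = u' ++ v' -> u = u' /\ v = v'.
Proof.
move=> szu eq_uv; split.
  by rewrite -(take_size_cat v szu) eq_uv take_size_cat.
by rewrite -(drop_size_cat v szu) eq_uv drop_size_cat.
Qed.

(** * Arities and membership for the operators on AD-relations *)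

Section ADRelationMembership.
Variable A : Type.
Implicit Types (X Y : ad_rel A) (u v w : seq A).

Lemma ad_in_size X w : ad_in X w -> size w = ad_ar X.
Proof. by case=> t _ <-; rewrite size_tuple. Qed.

Lemma ad_in_mk k P w : ad_in (ad_mk k P) w <-> size w = k /\ P w.
Proof.
split=> [[t Pt <-]|[szw Pw]]; first by rewrite size_tuple.
by exists (tcast szw (in_tuple w)); rewrite /= ?val_tcast.
Qed.

Lemma ad_in_tuple k (S : set (k.-tuple A)) t : ad_in (AdRel S) (tval t) <-> S t.
Proof. by split=> [[t' St' /val_inj <-]|St] //; exists t. Qed.

Lemma ad_rel_ext X Y :
  ad_ar X = ad_ar Y -> (forall w, ad_in X w <-> ad_in Y w) -> X = Y.
Proof.
case: X Y => k X [l Y] /= eq_kl; case: _ / eq_kl Y => Y eqXY.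
congr AdRel; apply/funext => t; apply/propext.
by rewrite -(ad_in_tuple X) -(ad_in_tuple Y).
Qed.

Lemma ad_ar_p X : ad_ar (ad_p X) = ad_ar X.
Proof. by rewrite /ad_p; case: ifP. Qed.

Lemma ad_ar_s X : ad_ar (ad_s X) = ad_ar X.
Proof. by rewrite /ad_s; case: ifP. Qed.

Lemma ad_in_p X a u : ad_in (ad_p X) (a :: u) <-> ad_in X (rcons u a).
Proof.
rewrite /ad_p; case: ifPn => [_|]; last first.
  (* At arity at most 1 the operator is the identity: for empty [u] both sides coincide, otherwise
     both fail because the sequence is too long. *)
  rewrite -leqNgt => X1; case: u => [|b u] //=.
  by split=> /ad_in_size; rewrite /= ?size_rcons => szX; rewrite -szX in X1.
rewrite ad_in_mk; split=> [[_ [u' [a' [[-> ->]]]]] //|Xua].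
by split; [rewrite -(ad_in_size Xua) size_rcons|exists u, a].
Qed.

Lemma ad_in_s X a b u :
  ad_in (ad_s X) (rcons (rcons u b) a) <-> ad_in X (rcons (rcons u a) b).
Proof.
rewrite /ad_s; case: ifPn => [_|]; last first.
  rewrite -leqNgt => X1.
  by split=> /ad_in_size; rewrite !size_rcons => szX; rewrite -szX in X1.
rewrite ad_in_mk; split=> [[_ [u' [a' [b' []]]]]|Xuab].
  by move=> /rcons_inj[/rcons_inj[-> ->] ->].
by split; [rewrite -(ad_in_size Xuab) !size_rcons|exists u, a, b].
Qed.

Lemma ad_ar_I X : 1 < ad_ar X -> ad_ar (ad_I X) = (ad_ar X).-1.
Proof. by rewrite /ad_I => ->. Qed.

Lemma ad_in_I X a u : 1 < ad_ar X ->
  ad_in (ad_I X) (rcons u a) <-> ad_in X (rcons (rcons u a) a).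
Proof.
rewrite /ad_I => ->; rewrite ad_in_mk; split=> [[_ [u' [a' []]]]|Xuaa].
  by move=> /rcons_inj[-> ->].
by split; [rewrite -(ad_in_size Xuaa) !size_rcons|exists u, a].
Qed.

Lemma ad_in_J X Y u v : size u = ad_ar X ->
  ad_in (ad_J X Y) (u ++ v) <-> ad_in X u /\ ad_in Y v.
Proof.
move=> szu; rewrite ad_in_mk; split=> [[_ [u' [v' [eq_uv Xu' Yv']]]]|[Xu Yv]].
  by have [-> ->] := cat_inj (etrans szu (esym (ad_in_size Xu'))) eq_uv.
by split; [rewrite size_cat (ad_in_size Xu) (ad_in_size Yv)|exists u, v].
Qed.

Lemma ad_ar_ex X : ad_ar (ad_ex X) = (ad_ar X).-1.
Proof. by rewrite /ad_ex; case: ifP => //; case: (ad_ar X). Qed.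

Lemma ad_in_ex X w : 0 < ad_ar X ->
  ad_in (ad_ex X) w <-> exists a, ad_in X (rcons w a).
Proof.
rewrite /ad_ex => ->; rewrite ad_in_mk; split=> [[]//|[a Xwa]].
by split; [rewrite -(ad_in_size Xwa) size_rcons|exists a].
Qed.

End ADRelationMembership.

(** Reads a tuple as an assignment to distinct variables; inhabitedness supplies the values
    elsewhere. *)
Lemma map_onto (A : Type) (y : seq nat) (w : seq A) :
  inhabited A -> uniq y -> size w = size y -> exists h, map h y = w.
Proof.
case=> a uniq_y szw; exists (fun z => nth a w (index z y)).
apply: (@eq_from_nth _ a) => [|i]; rewrite size_map // => lt_i_y.
by rewrite (nth_map 0) // index_uniq.
Qed.

Lemma map_override (A : Type) (h : nat -> A) (x : nat) (a : A) (y : seq nat) :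
  x \notin y -> map (fun z => if z == x then a else h z) y = map h y.
Proof.
move=> xNy; apply/eq_in_map => z zy; case: eqP => // eq_zx.
by rewrite -eq_zx zy in xNy.
Qed.

Section Expressiveness.
Variables (Sym : Type) (ar : Sym -> nat) (withe : bool).

(* [withe] tells whether e and equality atoms are allowed, so that both halves
   of the theorem are instances of the same argument. *)
Definition terms : set (term Sym) := [set T | withe || e_free T].

Definition atoms : set (formula ar) :=
  if withe then setU (@rel_atom Sym ar) (@eq_atom Sym ar) else @rel_atom Sym ar.

Lemma atomsP f : atoms f ->
  (exists R y, f = @FRel Sym ar R y) \/ (withe /\ exists x y, f = FEq x y).
Proof.
rewrite /atoms; case: withe => [[|]|]; first by left.
  by right.
by left.
Qed.

Lemma atoms_rel R (y : (ar R).-tuple nat) : atoms (FRel y).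
Proof. by rewrite /atoms; case: withe; [left|]; exists R, y. Qed.

Lemma atoms_eq x y : withe -> atoms (FEq x y).
Proof. by rewrite /atoms => ->; right; exists x, y. Qed.

(* The columns of T are labelled by y, possibly with repetitions. *)
Definition labels (T : term Sym) (y : seq nat) (g : formula ar) : Prop :=
  forall M : model ar, ad_ar (term_val M T) = size y /\
    forall h : nat -> dom M, sat h g <-> ad_in (term_val M T) (map h y).

Definition labelled (g : formula ar) (y : seq nat) : Prop :=
  exists2 T, terms T & labels T y g.

(** * From queries to terms *)

(** The operators [p] and [s] provide the two closure hypotheses for the predicate [labelled g]. *)
Lemma labelled_perm g y y' : perm_eq y y' -> labelled g y -> labelled g y'.
Proof.
apply: (@closed_perm_eq _ (labelled g)) => [u a|u a b] [T inT lab].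
- exists (TP T) => // M; have [arT labT] := lab M.
  split=> [|h] /=; first by rewrite ad_ar_p arT size_rcons.
  by rewrite ad_in_p -map_rcons.
- exists (TS T) => // M; have [arT labT] := lab M.
  split=> [|h] /=; first by rewrite ad_ar_s arT !size_rcons.
  by rewrite !map_rcons ad_in_s -!map_rcons.
Qed.

Lemma labelled_merge g u a :
  labelled g (rcons (rcons u a) a) -> labelled g (rcons u a).
Proof.
case=> T inT lab; exists (TI T) => // M; have [arT labT] := lab M.
have arT2 : 1 < ad_ar (term_val M T) by rewrite arT !size_rcons.
split=> [|h] /=; first by rewrite ad_ar_I // arT !size_rcons.
by rewrite !map_rcons ad_in_I // -!map_rcons.
Qed.

Lemma labelled_undup g y : labelled g y -> labelled g (undup y).
Proof.
suff gen u : labelled g (u ++ y) -> labelled g (u ++ undup y).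
  exact: (gen [::]).
elim: y u => //= a v IHv u; case: ifPn => [av|_]; last first.
  by rewrite -!(cat_rcons a) => /IHv.
move=> lab; apply: IHv; move: lab; case/splitPr: av => v1 v2 lab.
(* Both copies of [a] go to the end and are merged by [I]; the surviving copy then returns to the
   place of the later one, the occurrence that [undup] keeps. *)
have {}lab : labelled g (rcons (rcons (u ++ v1 ++ v2) a) a).
  apply: labelled_perm lab; apply/permP => q.
  by rewrite -!cats1 !count_cat /= !count_cat /=; lia.
apply: labelled_perm (labelled_merge lab); apply/permP => q.
by rewrite -!cats1 !count_cat /=; lia.
Qed.

Lemma labelled_conjunction g : conjunction atoms g -> labelled g (free_occ g).
Proof.
elim=> {g} [f /atomsP[[R [y ->]]|[e [x [y ->]]]]|
            f g _ [T1 in1 lab1] _ [T2 in2 lab2]].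
- exists (TRel R); first by rewrite /terms /= orbT.
  move=> M; split=> [|h] /=; first by rewrite size_tuple.
  by rewrite -ad_in_tuple.
- exists TEq; first by rewrite /terms /= orbF.
  move=> M; split=> // h /=; rewrite ad_in_mk /=.
  by split=> [->|[_ [a [-> ->]]]] //; split=> //; exists (h y).
- exists (TJ T1 T2).
    by move: in1 in2; rewrite /terms /=; case: withe => //= -> ->.
  move=> M; have [ar1 labT1] := lab1 M; have [ar2 labT2] := lab2 M.
  split=> [|h] /=; first by rewrite ar1 ar2 size_cat.
  by rewrite map_cat ad_in_J ?size_map // labT1 labT2.
Qed.

Lemma labelled_ex g y x : uniq y -> labelled g y ->
  labelled (FEx x g) [seq z <- y | z != x].
Proof.
move=> uniq_y; have [xy|xNy] := boolP (x \in y); last first.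
  have -> : [seq z <- y | z != x] = y.
    apply/all_filterP/allP => z zy; apply: contraNneq xNy => <- //.
  case=> T inT lab; exists T => // M; have [arT labT] := lab M.
  split=> // h /=; split=> [[a]|].
    by rewrite labT map_override.
  (* Quantifying a variable that labels no column is vacuous only because the domain is nonempty. *)
  case: (dom_inhabited M) => a Th; exists a.
  by rewrite labT map_override.
(* As the labels are distinct, [x] labels exactly one column; it is brought to the end and projected
   away. *)
have /labelled_perm/[apply] : perm_eq y (rcons [seq z <- y | z != x] x).
  rewrite perm_sym perm_rcons perm_sym -rem_filter //; exact: perm_to_rem.
set u := filter _ _ => -[T inT lab]; exists (TEx T) => // M.
have xNu : x \notin u by rewrite mem_filter eqxx.
have [arT labT] := lab M.
have arT1 : 0 < ad_ar (term_val M T) by rewrite arT size_rcons.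
split=> [|h] /=; first by rewrite ad_ar_ex arT size_rcons.
rewrite ad_in_ex //; split=> -[a Ta]; exists a; move: Ta.
  by rewrite labT map_rcons map_override // eqxx.
by rewrite labT map_rcons map_override // eqxx.
Qed.

Lemma labelled_query f : query atoms f -> labelled f (free_vars f).
Proof.
case=> xs [g [conj_g ->]].
apply: (@labelled_perm _ (undup (free_occ (foldr (@FEx _ ar) g xs)))).
  by rewrite perm_sym perm_sort.
elim: xs => [|x xs IHxs] /=; first exact/labelled_undup/labelled_conjunction.
by rewrite -filter_undup; apply: labelled_ex (undup_uniq _) IHxs.
Qed.

(** The labels [free_vars f] are distinct and already in the order used by [formula_val], so every
    tuple of the term comes from an assignment. *)
Lemma query_to_term f :
  query atoms f -> exists2 T, terms T & equivalent f T.
Proof.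
move=> /labelled_query[T inT lab]; exists T => // M _; have [arT labT] := lab M.
apply: ad_rel_ext => [//|w]; rewrite ad_in_mk; split=> [[_ [h [<-]]]|Tw].
  by rewrite labT.
have szw : size w = size (free_vars f) by rewrite (ad_in_size Tw) arT.
split=> //; have [|h hw] := map_onto (dom_inhabited M) _ szw.
  by rewrite sort_uniq undup_uniq.
by exists h; rewrite labT hw.
Qed.

(* Only used on quantifier-free formulas, so capture is not an issue. *)
Fixpoint rename (s : nat -> nat) (f : formula ar) : formula ar :=
  match f with
  | FRel R y => FRel (map_tuple s y)
  | FEq x y => FEq (s x) (s y)
  | FAnd f1 f2 => FAnd (rename s f1) (rename s f2)
  | FEx x f1 => FEx (s x) (rename s f1)
  end.

(** * From terms to queries *)

Lemma sat_rename s g (M : model ar) (h : nat -> dom M) :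
  conjunction atoms g -> sat h (rename s g) <-> sat (h \o s) g.
Proof.
elim=> {g} [f /atomsP[[R [y ->]]|[_ [x [y ->]]]]|f g _ IHf _ IHg] //=.
  suff -> : map_tuple h (map_tuple s y) = map_tuple (h \o s) y by [].
  by apply: val_inj; rewrite /= map_comp.
by rewrite IHf IHg.
Qed.

Lemma free_occ_rename s g :
  conjunction atoms g -> free_occ (rename s g) = map s (free_occ g).
Proof.
elim=> {g} [f /atomsP[[R [y ->]]|[_ [x [y ->]]]]|f g _ IHf _ IHg] //=.
by rewrite IHf IHg map_cat.
Qed.

Lemma conjunction_rename s g :
  conjunction atoms g -> conjunction atoms (rename s g).
Proof.
elim=> {g} [f /atomsP[[R [y ->]]|[e [x [y ->]]]]|f g _ IHf _ IHg] /=.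
- exact/conj_atom/atoms_rel.
- exact/conj_atom/atoms_eq.
- exact: conj_and.
Qed.

(** Unlike in [labels], the assignment is quantified existentially, so variables of [g] outside [y]
    are projected implicitly and [g] can stay quantifier-free. *)
Definition computes (T : term Sym) (y : seq nat) (g : formula ar) : Prop :=
  forall M : model ar, ad_ar (term_val M T) = size y /\
    forall w, size w = size y -> ad_in (term_val M T) w <->
      exists h : nat -> dom M, map h y = w /\ sat h g.

(** The left inverse [t] turns an assignment for [g] into one for the renamed formula. *)
Lemma computes_rename s t T y g : cancel s t -> conjunction atoms g ->
  computes T y g -> computes T (map s y) (rename s g).
Proof.
move=> sK conj_g comp M; have [arT compT] := comp M.
rewrite size_map; split=> // w szw; rewrite compT //.
split=> -[h [<- hg]].
  exists (h \o t); rewrite -map_comp sat_rename //.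
  suff -> : (h \o t) \o s = h by [].
  by apply/funext => z /=; rewrite sK.
by exists (h \o s); rewrite -sat_rename // -map_comp.
Qed.

(** Variables outside [y] are already projected by [computes], so an explicit quantifier over one of
    them changes nothing. *)
Lemma computes_ex T y x f :
  x \notin y -> computes T y f -> computes T y (FEx x f).
Proof.
move=> xNy comp M; have [arT compT] := comp M; split=> // w szw.
rewrite compT //; split=> -[h [<-]].
  move=> hf; exists h; split=> //; exists (h x).
  suff -> : (fun z => if z == x then h x else h z) = h by [].
  by apply/funext => z; case: eqP => // ->.
by case=> a haf; eexists; split; last exact: haf; rewrite map_override.
Qed.

Lemma computes_foldr_ex T y xs f : {in xs, forall x, x \notin y} ->
  computes T y f -> computes T y (foldr (@FEx _ ar) f xs).
Proof.
elim: xs => //= x xs IHxs xsNy comp.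
apply: computes_ex; first by apply: xsNy; rewrite mem_head.
by apply: IHxs comp => z zxs; apply: xsNy; rewrite in_cons zxs orbT.
Qed.

(** The inclusion of [y] in [free_occ g] ensures that, once the other variables are quantified,
    exactly those of [y] are free. *)
Definition conj_expressible (T : term Sym) : Prop :=
  exists y g, [/\ conjunction atoms g, uniq y, {subset y <= free_occ g}
                & computes T y g].

Lemma conj_expressible_rel R : conj_expressible (TRel R).
Proof.
exists (iota 0 (ar R)), (FRel (iota_tuple (ar R) 0)).
split=> //=; [exact/conj_atom/atoms_rel|exact: iota_uniq|].
move=> M; rewrite size_iota; split=> // w szw /=.
have inE (h : nat -> dom M) : map h (iota 0 (ar R)) = w ->
    ad_in (AdRel (@rel_val _ _ M R)) w <->
    rel_val (map_tuple h (iota_tuple (ar R) 0)).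
  by move=> <-; rewrite -ad_in_tuple.
split=> [Rw|[h [hw]]]; last by rewrite -inE.
have [||h hw] := @map_onto _ (iota 0 (ar R)) w (dom_inhabited M).
- exact: iota_uniq.
- by rewrite size_iota.
by exists h; rewrite -inE.
Qed.

Lemma conj_expressible_eq : withe -> conj_expressible TEq.
Proof.
move=> e; exists [:: 0; 1], (FEq 0 1).
split=> //; first exact/conj_atom/atoms_eq.
move=> M; split=> // w szw /=; rewrite ad_in_mk.
split=> [[_ [a ->]]|[h [<- ->]]]; first by exists (fun=> a).
by split=> //; exists (h 1).
Qed.

Lemma conj_expressible_p T : conj_expressible T -> conj_expressible (TP T).
Proof.
case=> y [g [conj_g uniq_y sub_y comp]].
case/lastP: y => [|u a] in uniq_y sub_y comp *.
  exists [::], g; split=> // M; have [arT compT] := comp M.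
  by rewrite /= /ad_p arT.
exists (a :: u), g; split=> //; first by rewrite /= -rcons_uniq.
  by move=> z; rewrite -mem_rcons => /sub_y.
move=> M; have [arT compT] := comp M.
split=> [|[//|b v] szv]; first by rewrite /= ad_ar_p arT size_rcons.
rewrite /= ad_in_p compT ?size_rcons //.
split=> -[h [hv hg]]; exists h; split=> //; move: hv.
  by rewrite map_rcons => /rcons_inj[-> ->].
by rewrite map_rcons => -[-> ->].
Qed.

Lemma conj_expressible_s T : conj_expressible T -> conj_expressible (TS T).
Proof.
case=> y [g [conj_g uniq_y sub_y comp]].
have [y1|] := leqP (size y) 1.
  exists y, g; split=> // M; have [arT compT] := comp M.
  by rewrite /= /ad_s arT ltnNge y1.
case/lastP: y => [//|y b] in uniq_y sub_y comp *.
case/lastP: y => [//|u a] in uniq_y sub_y comp * => _.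
have eq_swap : perm_eq (rcons (rcons u b) a) (rcons (rcons u a) b).
  by rewrite -!cats1 -!catA perm_cat2l perm_catC.
exists (rcons (rcons u b) a), g; split=> //.
- by rewrite (perm_uniq eq_swap).
- by move=> z; rewrite (perm_mem eq_swap) => /sub_y.
move=> M; have [arT compT] := comp M.
split=> [|w]; first by rewrite /= ad_ar_s arT !size_rcons.
case/lastP: w => [|w d]; first by rewrite size_rcons.
case/lastP: w => [|v c]; first by rewrite !size_rcons.
move=> szv; rewrite /= ad_in_s compT; last by rewrite !size_rcons in szv *.
split=> -[h [hv hg]]; exists h; split=> //; move: hv;
  by rewrite !map_rcons => /rcons_inj[/rcons_inj[-> ->] ->].
Qed.

Lemma conj_expressible_I T : conj_expressible T -> conj_expressible (TI T).
Proof.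
case=> y [g [conj_g uniq_y sub_y comp]].
have [y1|] := leqP (size y) 1.
  exists y, g; split=> // M; have [arT compT] := comp M.
  by rewrite /= /ad_I arT ltnNge y1.
case/lastP: y => [//|y b] in uniq_y sub_y comp *.
case/lastP: y => [//|u a] in uniq_y sub_y comp * => _.
have [bNua uniq_ua] : b \notin rcons u a /\ uniq (rcons u a).
  by move: uniq_y; rewrite rcons_uniq => /andP.
(* Identifying [b] with [a] expresses the equality of the last two columns without an equality
   atom. *)
pose s z := if z == b then a else z.
have sE : map s (rcons u a) = rcons u a by rewrite /s map_override // map_id.
exists (rcons u a), (rename s g); split=> //.
- exact: conjunction_rename.
- move=> z z_ua; rewrite free_occ_rename //.
  rewrite -sE in z_ua; case/mapP: z_ua => x x_ua ->; apply: map_f.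
  by apply: sub_y; rewrite mem_rcons in_cons x_ua orbT.
move=> M; have [arT compT] := comp M.
have arT2 : 1 < ad_ar (term_val M T) by rewrite arT !size_rcons.
split=> [|w]; first by rewrite /= ad_ar_I // arT !size_rcons.
case/lastP: w => [|v c szv]; first by rewrite size_rcons.
rewrite /= ad_in_I // compT; last by rewrite !size_rcons in szv *; rewrite szv.
split=> -[h [hv hg]].
  move: hv; rewrite !map_rcons => /rcons_inj[/rcons_inj[hv ha] hb].
  exists h; rewrite map_rcons hv ha sat_rename //; split=> //.
  suff -> : h \o s = h by [].
  by apply/funext => z /=; rewrite /s; case: eqP => // ->; rewrite ha hb.
(* Precomposing with [s] gives [b] the value of [a], as the repeated last entry demands. *)
exists (h \o s); rewrite -sat_rename //; split=> //.
rewrite map_rcons map_comp sE hv /= /s eqxx.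
by move: hv; rewrite map_rcons => /rcons_inj[_ ->].
Qed.

Lemma conj_expressible_J T1 T2 :
  conj_expressible T1 -> conj_expressible T2 -> conj_expressible (TJ T1 T2).
Proof.
case=> y1 [g1 [conj1 uniq1 sub1 comp1]] [y2 [g2 [conj2 uniq2 sub2 comp2]]].
(* Even and odd variables keep the two conjunctions apart; [half] is a left inverse of both
   renamings. *)
pose s1 z := z.*2; pose s2 z := z.*2.+1.
have s1K : cancel s1 half by move=> z; rewrite /s1 doubleK.
have s2K : cancel s2 half by move=> z; rewrite /s2 /= uphalf_double.
exists (map s1 y1 ++ map s2 y2), (FAnd (rename s1 g1) (rename s2 g2)); split.
- by apply: conj_and; apply: conjunction_rename.
- rewrite cat_uniq !map_inj_uniq ?uniq1 ?uniq2 //=; try exact: can_inj.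
  rewrite andbT; apply/hasPn => _ /mapP[z _ ->]; apply/mapP => -[x _].
  by move/(congr1 odd); rewrite /s1 /s2 /= !odd_double.
- move=> z; rewrite /= !free_occ_rename // !mem_cat.
  by case/orP=> /mapP[x xy ->]; rewrite map_f ?orbT //;
    [apply: sub1|apply: sub2].
move=> M; have [ar1 compT1] := comp1 M; have [ar2 compT2] := comp2 M.
rewrite size_cat !size_map; split=> [|w szw /=]; first by rewrite /= ar1 ar2.
have szw1 : size (take (size y1) w) = size y1.
  by rewrite size_takel // szw leq_addr.
have szw2 : size (drop (size y1) w) = size y2 by rewrite size_drop szw addKn.
rewrite -(cat_take_drop (size y1) w) ad_in_J ?ar1 // compT1 // compT2 //.
split=> [[[h1 [<- sat1]] [h2 [<- sat2]]]|[h [hw []]]].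
  (* The two assignments are glued by parity. *)
  pose h z := if odd z then h2 z./2 else h1 z./2.
  have hs1 : h \o s1 = h1.
    by apply/funext => z /=; rewrite /h /s1 odd_double doubleK.
  have hs2 : h \o s2 = h2.
    by apply/funext => z /=; rewrite /h /s2 /= odd_double /= uphalf_double.
  exists h; rewrite map_cat -!map_comp !sat_rename //.
  by rewrite hs1 hs2.
rewrite !sat_rename // => sat1 sat2.
rewrite map_cat -!map_comp in hw.
have [|hw1 hw2] := cat_inj _ hw; first by rewrite size_map szw1.
by split; [exists (h \o s1)|exists (h \o s2)].
Qed.

Lemma conj_expressible_ex T : conj_expressible T -> conj_expressible (TEx T).
Proof.
case=> y [g [conj_g uniq_y sub_y comp]].
case/lastP: y => [|u a] in uniq_y sub_y comp *.
  exists [::], g; split=> // M; have [arT compT] := comp M.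
  by rewrite /= /ad_ex arT.
(* The label [a] is merely dropped; its variable stays free in [g]. *)
exists u, g; split=> //.
- by move: uniq_y; rewrite rcons_uniq => /andP[].
- by move=> z zu; apply: sub_y; rewrite mem_rcons in_cons zu orbT.
move=> M; have [arT compT] := comp M.
have arT1 : 0 < ad_ar (term_val M T) by rewrite arT size_rcons.
split=> [|w szw]; first by rewrite /= ad_ar_ex arT size_rcons.
rewrite /= ad_in_ex //; split=> [[b]|[h [<- hg]]].
  rewrite compT ?size_rcons ?szw // => -[h [+ hg]].
  by rewrite map_rcons => /rcons_inj[hw _]; exists h.
exists (h a); rewrite -map_rcons compT ?size_map //.
by exists h.
Qed.

Lemma term_conj_expressible T : terms T -> conj_expressible T.
Proof.
rewrite /terms /=; elim: T => /= [R|e|T IHT|T IHT|T IHT|T1 IH1 T2 IH2|T IHT].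
- by move=> _; apply: conj_expressible_rel.
- by rewrite orbF in e; apply: conj_expressible_eq.
- by move=> /IHT; apply: conj_expressible_p.
- by move=> /IHT; apply: conj_expressible_s.
- by move=> /IHT; apply: conj_expressible_I.
- by rewrite orb_andr => /andP[/IH1 + /IH2]; apply: conj_expressible_J.
- by move=> /IHT; apply: conj_expressible_ex.
Qed.

Lemma mem_free_occ_foldr_ex (g : formula ar) xs z :
  (z \in free_occ (foldr (@FEx _ ar) g xs)) =
  (z \in free_occ g) && (z \notin xs).
Proof.
elim: xs => [|x xs IHxs] /=; first by rewrite andbT.
by rewrite mem_filter IHxs in_cons negb_or andbCA.
Qed.

Lemma term_to_query T : terms T -> exists2 f, query atoms f & equivalent f T.
Proof.
move=> /term_conj_expressible[y [g [conj_g uniq_y sub_y comp]]].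
(* [formula_val] orders columns by variable index, so [s] sends [y] in order to the first [k]
   variables and shifts all others to [k] or beyond; [t] undoes it. *)
pose k := size y; pose s z := if z \in y then index z y else k + z.
pose t i := if i < k then nth 0 y i else i - k.
have sK : cancel s t.
  move=> z; rewrite /t /s; have [zy|_] := boolP (z \in y).
    by rewrite /k index_mem zy nth_index.
  by rewrite ltnNge leq_addr addKn.
have sy : map s y = iota 0 k.
  apply: (@eq_from_nth _ 0) => [|i]; rewrite size_map ?size_iota // => lt_i.
  by rewrite (nth_map 0) // nth_iota // /s mem_nth // index_uniq.
have {comp} := computes_rename sK conj_g comp; rewrite sy.
have conj_sg := conjunction_rename s conj_g.
(* The variables to quantify are those that label no column. *)
pose xs := [seq z <- free_occ (rename s g) | k <= z].
have /computes_foldr_ex/[apply] : {in xs, forall x, x \notin iota 0 k}.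
  by move=> x; rewrite mem_filter mem_iota add0n -leqNgt => /andP[].
set f := foldr _ _ _ => comp; exists f; first by exists xs, (rename s g).
have fvE : free_vars f = iota 0 k.
  apply: (sorted_eq leq_trans anti_leq).
  - exact: sort_sorted leq_total _.
  - exact: iota_sorted.
  rewrite perm_sort uniq_perm ?undup_uniq ?iota_uniq // => z.
  rewrite mem_undup mem_free_occ_foldr_ex mem_iota add0n /= mem_filter.
  rewrite negb_and -ltnNge andb_orr andbN orbF andbC.
  case: ltnP => // lt_zk /=; rewrite free_occ_rename //.
  have : z \in map s y by rewrite sy mem_iota.
  by case/mapP => x xy ->; rewrite map_f // sub_y.
move=> M _; have [arT compT] := comp M.
apply: ad_rel_ext => [|w]; first by rewrite /= fvE arT.
rewrite ad_in_mk fvE; split=> [[szw]|Tw]; first by rewrite -compT.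
have szw : size w = size (iota 0 k) by rewrite (ad_in_size Tw) arT.
by rewrite -compT.
Qed.

Lemma equiexpressive_query : equiexpressive terms (query atoms).
Proof. by split; [exact: term_to_query|exact: query_to_term]. Qed.

End Expressiveness.

Theorem proposition5p1 (Sym : Type) (ar : Sym -> nat) :
  equiexpressive (@GRA_epsIJex Sym) (@CQE Sym ar) /\
  equiexpressive (@GRA_psIJex Sym) (@CQ Sym ar).
Proof.
split; last exact: (equiexpressive_query ar false).
have [to_query to_term] := equiexpressive_query ar true.
split=> [T _|f /to_term[T _ eqT]]; first exact: to_query.
by exists T.
Qed.
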